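(* Let $X$ and $U^1,\dots,U^m$ be convex sets, each equipped with a proximal setup: $X$ with norm $\|\cdot\|_X$, distance-generating function $\omega$ and set width $\Omega_X$; $U^i$ with norm $\|\cdot\|_{(i)}$, distance-generating function $\omega^i$ and set width at most $\Omega_U<\infty$. For $i\in[m]$ let $f^i:X\times U^i\to\mathbb{R}$ be convex in $x$ and concave in $u^i$, with $\|\nabla_xf^i(x,u^i)\|_{X,*}\le G_X<\infty$ and $\|\nabla_uf^i(x,u^i)\|_{(i),*}\le G_U<\infty$ for all $x\in X,u^i\in U^i$. Suppose that for each $i\in[m]$ there are $\alpha_U^i>0$ and $\alpha_X^i>0$ such that $-f^i(x,u^i)-\alpha_U^i\omega^i(u^i)$ is convex in $u^i$ for every fixed $x\in X$, and $f^i(x,u^i)-\alpha_X^i\omega(x)$ is convex in $x$ for every fixed $u^i\in U^i$; set $\alpha_U=\min_i\alpha_U^i$, $\alpha_X=\min_i\alpha_X^i$. Then for every $\epsilon>0$ the $\epsilon$-robust feasibility problem is solved (in the sense of the decision rule given in the context, for any fixed $\tau\in(0,1)$) within $T=O(1/\epsilon)$ iterations, the hidden constant being independent of $\epsilon$, using the weights $\theta_t=\frac{2t}{T(T+1)}$ and the following iterations: $x_1$ is the $\omega$-center of $X$, $u_1^i$ is the $\omega^i$-center of $U^i$, and for $t\ge1$ $$u_{t+1}^i=\mathrm{Prox}^{U^i}_{u_t^i}\!\left(-\tfrac{2}{\alpha_U(t+1)}\nabla_uf^i(x_t,u_t^i)\right)\ (i\in[m]),\qquad x_{t+1}=\mathrm{Prox}^{X}_{x_t}\!\left(\tfrac{2}{\alpha_X(t+1)}\nabla_xf^{i(t)}(x_t,u_t^{i(t)})\right),$$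 where $i(t)\in\arg\max_{i\in[m]}f^i(x_t,u_t^i)$. Here both $x_t$ and $u_t$ are computed with the knowledge of only past iterates $x_{t-1},u_{t-1}$.
   Context: $[m]=\{1,\dots,m\}$; $u_t=[u_t^1;\dots;u_t^m]$. $\epsilon$-robust feasibility problem: either find $x\in X$ with $\sup_{u^i\in U^i}f^i(x,u^i)\le\epsilon$ for all $i\in[m]$, or correctly declare infeasibility, i.e. that for every $x\in X$ there is $i\in[m]$ with $\sup_{u^i\in U^i}f^i(x,u^i)>0$. Decision rule: after $T$ iterations with weights $\theta$, if $\max_{i\in[m]}\sum_{t=1}^T\theta_tf^i(x_t,u_t^i)\le(1-\tau)\epsilon$, output $\bar x_T=\sum_{t=1}^T\theta_tx_t$ as an $\epsilon$-feasible point; otherwise declare infeasibility. ''Solved'' means that whichever of the two outputs is produced is correct. $\nabla_xf^i$ is a (selected) subgradient of $f^i(\cdot,u^i)$; $\nabla_uf^i$ is a (selected) supergradient of the concave function $f^i(x,\cdot)$. A subscript $*$ on a norm denotes the dual norm. Proximal setup for a convex domain $Z$ in a Euclidean space $E$: (i) a norm $\|\cdot\|$ on $E$ with dual norm $\|\zeta\|_*=\max_{\|z\|\le 1}\langle\zeta,z\rangle$; (ii) a distance-generating function $\omega:Z\to\mathbb{R}$, convex and continuous on $Z$, admitting a selection of subgradients $\nabla\omega(z)$ that is continuous on $Z^\circ:=\{z\in Z:\partial\omega(z)\ne\emptyset\}$, and strongly convex with modulus 1: $\langle\nabla\omega(z')-\nabla\omega(z''),z'-z''\rangle\ge\|z'-z''\|^2$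 for all $z',z''\in Z^\circ$; (iii) Bregman distance $V_z(z'):=\omega(z')-\omega(z)-\langle\nabla\omega(z),z'-z\rangle$ for $z\in Z^\circ$, $z'\in Z$; (iv) prox-mapping $\mathrm{Prox}^Z_z(\xi):=\arg\min_{z'\in Z}\{\langle\xi,z'\rangle+V_z(z')\}$, a map $E\to Z^\circ$, for $z\in Z^\circ$; (v) $\omega$-center $z_\omega:=\arg\min_{z\in Z}\omega(z)$; (vi) set width $\Omega:=\max_{z\in Z}V_{z_\omega}(z)$. Existence of these minimizers and of the maximum is part of the setup. *)

(* Defs.v *)
From HB Require Import structures.
From mathcomp Require Import all_boot all_order all_algebra.
From mathcomp Require Import all_classical all_reals all_analysis.

Set Implicit Arguments.
Unset Strict Implicit.
Unset Printing Implicit Defensive.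

Import Order.TTheory GRing.Theory Num.Theory.
Import numFieldNormedType.Exports.

Local Open Scope classical_set_scope.
Local Open Scope ring_scope.

(* A finite-dimensional space carrying the norm of a proximal setup.  The
   inner product of the Euclidean space is a separate form [ip] and need not
   induce this norm. *)
#[short(type="normedVectType")]
HB.structure Definition NormedVector (R : numFieldType) :=
  {E of NormedModule R E & Vector R E}.

Section proximal.
Context {R : realType} {E : normedVectType R}.
Variable ip : {dot E for idfun}.

(* The supremum is taken in the extended reals, so that it has no default
   value; it is the maximum of a linear form over the unit ball. *)
Definition dual_norm (zeta : E) : \bar R :=
  ereal_sup [set (ip zeta z)%:E | z in [set z : E | `|z| <= 1]].

(* Functions on [Z] are given as functions on [E], of which only the values on
   [Z] are used; in particular subgradients are relative to [Z]. *)
Definition subdifferential (Z : set E) (h : E -> R) (z : E) : set E :=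
  [set g | forall z', Z z' -> h z + ip g (z' - z) <= h z'].

Definition superdifferential (Z : set E) (h : E -> R) (z : E) : set E :=
  [set g | forall z', Z z' -> h z' <= h z + ip g (z' - z)].

Definition subdiff_domain (Z : set E) (h : E -> R) : set E :=
  [set z | Z z /\ subdifferential Z h z !=set0].

Definition argmin (Z : set E) (h : E -> R) : set E :=
  [set z | Z z /\ forall z', Z z' -> h z <= h z'].

Definition bregman (omega : E -> R) (domega : E -> E) (z z' : E) : R :=
  omega z' - omega z - ip (domega z) (z' - z).

(* [prox_map z] is only constrained for [z] in [subdiff_domain prox_dom dgf].
   There, and for the center, the minimizer is unique by strong convexity, so
   that storing it as data involves no choice. *)
Record prox_setup := ProxSetup {
  prox_dom : set E;
  dgf : E -> R;
  grad_dgf : E -> E;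
  prox_map : E -> E -> E;
  prox_center : E;
  prox_width : R;
  prox_dom_convex : convex_set prox_dom;
  dgf_convex : convex_function prox_dom dgf;
  dgf_continuous : {within prox_dom, continuous dgf};
  grad_dgfP : forall z, subdiff_domain prox_dom dgf z ->
    subdifferential prox_dom dgf z (grad_dgf z);
  grad_dgf_continuous :
    {within subdiff_domain prox_dom dgf, continuous grad_dgf};
  dgf_strongly_convex : forall z' z'',
    subdiff_domain prox_dom dgf z' -> subdiff_domain prox_dom dgf z'' ->
    `|z' - z''| ^+ 2 <= ip (grad_dgf z' - grad_dgf z'') (z' - z'');
  prox_map_domain : forall z xi, subdiff_domain prox_dom dgf z ->
    subdiff_domain prox_dom dgf (prox_map z xi);
  prox_mapP : forall z xi, subdiff_domain prox_dom dgf z ->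
    argmin prox_dom (fun z' => ip xi z' + bregman dgf grad_dgf z z')
      (prox_map z xi);
  prox_centerP : argmin prox_dom dgf prox_center;
  prox_width_attained : exists2 z, prox_dom z &
    bregman dgf grad_dgf prox_center z = prox_width;
  prox_width_max : forall z, prox_dom z ->
    bregman dgf grad_dgf prox_center z <= prox_width }.

End proximal.

Section robust_feasibility.
Context {R : realType} {EX : normedVectType R} {m : nat}.
Context {EU : 'I_m.+1 -> normedVectType R}.
Variables (X : set EX) (U : forall i, set (EU i)).
Variable f : forall i, EX -> EU i -> R.

Definition robust_value (i : 'I_m.+1) (x : EX) : \bar R :=
  ereal_sup [set (f x u)%:E | u in @U i].

Definition robust_feasible (eps : R) (x : EX) : Prop :=
  X x /\ forall i, (robust_value i x <= eps%:E)%E.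

Definition robust_infeasible : Prop :=
  forall x, X x -> exists i, (0 < robust_value i x)%E.

(* The sequences are indexed from 1; their values at 0 are never used. *)
Definition solved_by_decision_rule (theta : nat -> R)
    (x : nat -> EX) (u : nat -> forall i, EU i) (tau eps : R) (T : nat) : Prop :=
  let s i := \sum_(1 <= t < T.+1) theta t * f (x t) (u t i) in
  if \big[Num.max/s ord0]_(i < m.+1) s i <= (1 - tau) * eps
  then robust_feasible eps (\sum_(1 <= t < T.+1) theta t *: x t)
  else robust_infeasible.

End robust_feasibility.

(* Main.v *)
Require Import Defs.
From HB Require Import structures.
From mathcomp Require Import all_boot all_order all_algebra.
From mathcomp Require Import all_classical all_reals all_analysis.
From mathcomp Require Import ring lra.

Set Implicit Arguments.
Unset Strict Implicit.
Unset Printing Implicit Defensive.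

Import Order.TTheory GRing.Theory Num.Theory.
Import numFieldNormedType.Exports.

Local Open Scope classical_set_scope.
Local Open Scope ring_scope.

(** Write [V] for a Bregman distance.  Each prox-iteration is a subgradient
    method on functions [f_t] that are [alpha]-strongly convex relative to the
    distance-generating function, with step [2 / (alpha (t+1))].

    One prox-step ([prox_step]) bounds [gamma <g_t, z_t - x>] by
    [V_(z_t)(x) - V_(z_(t+1))(x) + gamma^2 G^2], and strong convexity
    ([subgradient_strong_convexity]) bounds [f_t(z_t) - f_t(x)] by
    [<g_t, z_t - x> - alpha V_(z_t)(x)].  With the weights [t], the coefficient
    of [V_(z_t)(x)] is [alpha t (t+1) / 2 - alpha t = alpha (t-1) t / 2], which
    is the coefficient that step [t - 1] leaves behind; so the sum telescopes
    from a first coefficient equal to zero, and the weighted regret is at most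
    [4 G^2 / (alpha (T+1))] ([prox_regret]).

    This is applied to the adversary [u^i] with the functions [- f^i(x_t, .)]
    and to [x] with the functions [f^(i(t))(., u_t)].  If every weighted sum
    [sum theta_t f^i(x_t, u_t^i)] is at most [(1 - tau) eps], then convexity in
    [x] and the regret of [u^i] give [f^i(xbar, v) <= eps] for all [v] as soon
    as that regret is at most [tau eps].  Otherwise
    [sum theta_t f^(i(t))(x_t, u_t)], which dominates each of these sums by the
    choice of [i(t)], exceeds [(1 - tau) eps]; a point [x] with all
    [f^i(x, .) <= 0] would then contradict the regret of [x].  Both regrets are
    small enough once [T >= C / eps].

    The delicate point is that the proximal setup speaks of one selected
    subgradient [grad omega], defined only where subgradients exist, while the
    subgradients of [f] are arbitrary, also on the boundary of the domain.
    Convexity alone does not make [g - alpha grad omega(z)] a subgradient of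
    [f - alpha omega]; what is needed is that the slope of [omega] at [z]
    towards any point of the domain is at most the one predicted by
    [grad omega(z)] ([directional_derivative_le]).  This follows from the
    continuity of [grad omega] once the points with a subgradient are known to
    be dense in the domain ([subdiff_domain_dense]).  Density holds because a
    convex function has a subgradient at every relative interior point, by a
    finite-dimensional Hahn-Banach argument ([hahn_banach],
    [core_point_subgradient]), and each point of the domain is the end of a
    segment of relative interior points. *)

Lemma eq_ler (R : numDomainType) (x y : R) : x = y -> x <= y.
Proof. by move=> ->. Qed.

(** * Convexity *)

Section convexity.
Context {R : realType} {E : lmodType R}.
Implicit Types (Z : set E) (h : E -> R).

Lemma convex_set_segment Z : convex_set Z -> forall x y (t : R),
  Z x -> Z y -> 0 <= t <= 1 -> Z (t *: x + (1 - t) *: y).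
Proof.
move=> cZ x y t Zx Zy /andP[t0 t1].
have := cZ x y (Itv01 t0 t1).
by rewrite !inE /conv/=; apply.
Qed.

Lemma convex_function_chord Z h : convex_function Z h -> forall x y (t : R),
  Z x -> Z y -> 0 <= t <= 1 ->
  h (t *: x + (1 - t) *: y) <= t * h x + (1 - t) * h y.
Proof.
move=> ch x y t Zx Zy /andP[t0 t1].
have := ch (Itv01 t0 t1) x y.
by rewrite !inE /conv/=; apply.
Qed.

End convexity.

Section convex_sums.
Context {R : realType} {E : lmodType R}.
Variables (Z : set E) (h : E -> R).
Hypotheses (cZ : convex_set Z) (ch : convex_function Z h).

(** Jensen's inequality, for weights of any total, so that the induction can
    split off one of them and keep the others. *)
Lemma jensen (I : eqType) (s : seq I) (w : I -> R) (x : I -> E) :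
  (0 < size s)%N ->
  (forall t, t \in s -> 0 < w t) -> (forall t, t \in s -> Z (x t)) ->
  let W := \sum_(t <- s) w t in
  [/\ 0 < W, Z (W^-1 *: \sum_(t <- s) w t *: x t) &
    h (W^-1 *: \sum_(t <- s) w t *: x t) <= W^-1 * \sum_(t <- s) w t * h (x t)].
Proof.
elim: s => [//|a [_ _|b s IH _]] w0 Zx.
  have wa : 0 < w a by apply: w0; rewrite mem_head.
  rewrite /= !big_seq1 scalerA mulrA mulVf ?gt_eqF// scale1r mul1r.
  by split => //; apply: Zx; rewrite mem_head.
have wa : 0 < w a by apply: w0; rewrite mem_head.
have Za : Z (x a) by apply: Zx; rewrite mem_head.
have [] := IH isT.
- by move=> t ts; apply: w0; rewrite in_cons ts orbT.
- by move=> t ts; apply: Zx; rewrite in_cons ts orbT.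
move: (b :: s) => {IH w0 Zx}s S0 Zy hy; rewrite /= !big_cons.
set S := \sum_(t <- s) w t in S0 Zy hy *.
set y := S^-1 *: _ in Zy hy *.
have Sn0 : S != 0 by rewrite gt_eqF.
have wS0 : 0 < w a + S by rewrite addr_gt0.
have wSn0 : w a + S != 0 by rewrite gt_eqF.
have t01 : 0 <= w a / (w a + S) <= 1.
  apply/andP; split; first exact: divr_ge0 (ltW _) (ltW _).
  by rewrite ler_pdivrMr// mul1r lerDl ltW.
have -> : (w a + S)^-1 *: (w a *: x a + \sum_(j <- s) w j *: x j) =
    (w a / (w a + S)) *: x a + (1 - w a / (w a + S)) *: y.
  rewrite scalerDr scalerA mulrC; congr (_ + _).
  by rewrite /y scalerA; congr (_ *: _); field; rewrite Sn0.
split=> //; first exact: convex_set_segment.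
apply: (le_trans (convex_function_chord ch Za Zy t01)).
rewrite mulrDr mulrA [_^-1 * w a]mulrC lerD2l.
have -> : 1 - w a / (w a + S) = S / (w a + S) by field.
have SW0 : 0 <= S / (w a + S) by exact: divr_ge0 (ltW _) (ltW _).
apply: (le_trans (ler_wpM2l SW0 hy)); rewrite mulrA.
by rewrite [X in X * _ <= _]mulrAC mulfV// mul1r.
Qed.

End convex_sums.

(** * Inner products *)

Section inner_product.
Context {R : realType} {E : lmodType R} (ip : {dot E for idfun}).

Lemma ipZr a u v : ip u (a *: v) = a * ip u v.
Proof. by rewrite linearZr_LR. Qed.

Lemma ipZl a u v : ip (a *: u) v = a * ip u v.
Proof. by rewrite linearZl_LR. Qed.

Lemma ipDr u v w : ip u (v + w) = ip u v + ip u w.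
Proof. exact: linearDr. Qed.

Lemma ipDl u v w : ip (u + v) w = ip u w + ip v w.
Proof. exact: linearDl. Qed.

Lemma ipNr u v : ip u (- v) = - ip u v.
Proof. exact: linearNr. Qed.

Lemma ipBr u v w : ip u (v - w) = ip u v - ip u w.
Proof. exact: linearBr. Qed.

Lemma ipBl u v w : ip (u - v) w = ip u w - ip v w.
Proof. exact: linearBl. Qed.

Lemma ip_sumr u (I : Type) (s : seq I) (F : I -> E) :
  ip u (\sum_(i <- s) F i) = \sum_(i <- s) ip u (F i).
Proof. exact: linear_sumr. Qed.

Lemma ip_suml u (I : Type) (s : seq I) (F : I -> E) :
  ip (\sum_(i <- s) F i) u = \sum_(i <- s) ip (F i) u.
Proof. exact: linear_sumlz. Qed.

Lemma ip_gt0 u : u != 0 -> 0 < ip u u.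
Proof. exact: neq0_dnorm_gt0. Qed.

(** Turns an identity between linear combinations of vectors into one between
    scalars, which [ring] and [field] decide. *)
Lemma ip_inj x y : (forall u, ip u x = ip u y) -> x = y.
Proof.
move=> xy; apply/eqP; rewrite -subr_eq0; apply/negPn/negP => /ip_gt0.
by rewrite ipBr xy subrr ltxx.
Qed.

End inner_product.

(** * Sublinear functionals and the Hahn-Banach theorem *)

Section sublinear.
Context {R : realType} {E : lmodType R}.

Definition sublinear (q : E -> R) :=
  (forall x y, q (x + y) <= q x + q y) /\
  (forall (l : R) x, 0 < l -> q (l *: x) <= l * q x).

Lemma sublinear_eqZ q : sublinear q -> forall (l : R) x, 0 < l -> q (l *: x) = l * q x.
Proof.
move=> [_ qZ] l x l0; apply/eqP; rewrite eq_le qZ//=.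
rewrite -ler_pdivlMl//.
by have := qZ l^-1 (l *: x); rewrite scalerA mulVf ?gt_eqF// scale1r invr_gt0; apply.
Qed.

Lemma sublinear0 q : sublinear q -> q 0 = 0.
Proof.
move=> sq; have := sublinear_eqZ sq 0 (_ : 0 < 2 :> R).
by rewrite scaler0 => /(_ (ltr0Sn _ _)); lra.
Qed.

Lemma sublinear_opp q x : sublinear q -> 0 <= q x + q (- x).
Proof.
by move=> sq; rewrite -(sublinear0 sq) -(subrr x); exact: sq.1.
Qed.

(** The witness is [q' x = inf_(t >= 0) (q (x + t a) - t q a)]: taking [t = 0]
    gives [q' <= q] and taking [t = 1] at [x = - a] gives [q' (- a) <= - q a],
    so that [q'] is linear along [a].  As [q' <= q], linearity along a direction
    where [q] already had it is kept. *)
Lemma sublinear_step q a : sublinear q -> exists q', [/\ sublinear q',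
  forall x, q' x <= q x, q' a + q' (- a) <= 0 &
  forall b, q b + q (- b) <= 0 -> q' b + q' (- b) <= 0].
Proof.
move=> sq.
pose A x := [set q (x + t *: a) - t * q a | t in [set t | 0 <= t]].
have An0 x : A x !=set0 by exists (q (x + 0 *: a) - 0 * q a), 0 => //=.
(* subadditivity of [q] bounds the infimum from below *)
have Alb x : lbound (A x) (- q (- x)).
  move=> _ [t /= t0 <-].
  suff: t * q a <= q (x + t *: a) + q (- x) by lra.
  move: t0; rewrite le_eqVlt => /predU1P[<-|t0].
    by rewrite mul0r scale0r addr0 sublinear_opp.
  rewrite -(sublinear_eqZ sq)//.
  by apply: le_trans (sq.1 _ _); rewrite addrAC subrr add0r.
pose q' x := inf (A x).
have Ahl x : has_lbound (A x) by exists (- q (- x)).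
have q'le x t : 0 <= t -> q' x <= q (x + t *: a) - t * q a.
  by move=> t0; apply: ge_inf => //; exists t.
have q'ge x b : (forall t, 0 <= t -> b <= q (x + t *: a) - t * q a) -> b <= q' x.
  by move=> H; apply: lb_le_inf => // _ [t /= t0 <-]; exact: H.
have q'q x : q' x <= q x.
  by have := q'le x 0 (lexx _); rewrite scale0r mul0r addr0 subr0.
exists q'; split => //.
- split=> [x y|l x l0].
    rewrite -lerBlDr; apply: (q'ge) => t t0.
    rewrite lerBlDr -lerBlDl; apply: (q'ge) => s s0.
    rewrite lerBlDr; apply: le_trans (q'le _ (s + t) (addr_ge0 s0 t0)) _.
    rewrite mulrDl scalerDl [s *: a + _]addrC addrACA.
    by have := sq.1 (x + t *: a) (y + s *: a); lra.
  rewrite -ler_pdivrMl//; apply: (q'ge) => t t0.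
  rewrite ler_pdivrMl//; apply: le_trans (q'le _ (l * t) _) _.
    by rewrite mulr_ge0// ltW.
  by rewrite -scalerA -scalerDr (sublinear_eqZ sq)// mulrBr mulrA.
- have := q'q a; have := q'le (- a) 1 ler01.
  by rewrite scale1r addNr mul1r (sublinear0 sq); lra.
- by move=> b; have := q'q b; have := q'q (- b); lra.
Qed.

Lemma sublinear_linear_minorant q (s : seq E) : sublinear q -> exists q',
  [/\ sublinear q', forall x, q' x <= q x &
  forall a, a \in s -> q' a + q' (- a) <= 0].
Proof.
move=> sq; elim: s => [|a s [q1 [sq1 q1q q1s]]]; first by exists q.
have [q2 [sq2 q2q1 q2a q2s]] := sublinear_step a sq1.
exists q2; split => // [x|b].
  exact: le_trans (q1q x).
by rewrite in_cons => /predU1P[->//|/q1s/q2s].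
Qed.

Lemma sublinear_linear q : sublinear q -> (forall x, q x + q (- x) <= 0) ->
  (forall x y, q (x + y) = q x + q y) /\ (forall a x, q (a *: x) = a * q x).
Proof.
move=> sq qlin.
have qN x : q (- x) = - q x.
  by have := qlin x; have := sublinear_opp x sq; lra.
split=> [x y|a x].
  apply/eqP; rewrite eq_le sq.1/= -lerN2 opprD -!qN opprD.
  exact: sq.1.
have [a0|a0|->] := ltgtP a 0.
- rewrite -[a]opprK scaleNr qN mulNr (sublinear_eqZ sq)// oppr_gt0//.
- exact: sublinear_eqZ.
- by rewrite scale0r mul0r (sublinear0 sq).
Qed.

End sublinear.

Section finite_dimension.
Import VectorInternalTheory.
Context {R : realType} {E : vectType R}.

Definition stdbasis (i : 'I_(dim E)) : E := r2v (delta_mx 0 i).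

Lemma stdbasisE (x : E) : x = \sum_i v2r x 0 i *: stdbasis i.
Proof.
rewrite -{1}[x]v2rK [v2r x in LHS]row_sum_delta linear_sum/=.
by apply: eq_bigr => i _; rewrite linearZ.
Qed.

(** The coordinates of the representing vector solve a linear system with the
    Gram matrix of the basis, which is invertible as [ip] is definite. *)
Lemma riesz (ip : {dot E for idfun}) (phi : E -> R) :
  (forall x y, phi (x + y) = phi x + phi y) ->
  (forall a x, phi (a *: x) = a * phi x) ->
  exists g, forall x, ip g x = phi x.
Proof.
move=> phiD phiZ.
have phi0 : phi 0 = 0 by rewrite -(scale0r 0) phiZ mul0r.
pose A : 'M[R]_(dim E) := \matrix_(i, j) ip (stdbasis i) (stdbasis j).
have ipA (v : 'rV_(dim E)) j : ip (r2v v) (stdbasis j) = (v *m A) 0 j.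
  rewrite [r2v v]stdbasisE r2vK ip_suml mxE; apply: eq_bigr => i _.
  by rewrite ipZl mxE.
have Au : A \in unitmx.
  rewrite -row_free_unit; apply: inj_row_free => v vA0.
  apply: (@r2v_inj _ E); rewrite linear0; apply/eqP/negPn/negP => /(ip_gt0 ip).
  rewrite [X in ip _ X]stdbasisE ip_sumr big1 ?ltxx// => i _.
  by rewrite ipZr ipA vA0 mxE mulr0.
exists (r2v ((\row_j phi (stdbasis j)) *m invmx A)) => x.
rewrite [x]stdbasisE ip_sumr (big_morph phi phiD phi0).
by apply: eq_bigr => i _; rewrite ipZr ipA mulmxKV// mxE phiZ.
Qed.

(** Making [q] linear along each vector of a basis makes it linear. *)
Lemma hahn_banach (ip : {dot E for idfun}) (q : E -> R) :
  sublinear q -> exists g, forall x, ip g x <= q x.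
Proof.
move=> /(sublinear_linear_minorant [seq stdbasis i | i : 'I_(dim E)]).
move=> [q' [sq' q'q q'b]].
have lin x : q' x + q' (- x) <= 0.
  rewrite [x]stdbasisE.
  elim/big_ind : _ => [|y z yl zl|i _].
  - by rewrite oppr0 (sublinear0 sq') addr0.
  - by rewrite opprD; have := sq'.1 y z; have := sq'.1 (- y) (- z); lra.
  set b := stdbasis i; set a := v2r x 0 i.
  have bl : q' b + q' (- b) <= 0 by apply: q'b; rewrite map_f// mem_enum.
  have pos l : 0 < l -> q' (l *: b) + q' (- (l *: b)) <= 0.
    move=> l0; rewrite -scalerN !(sublinear_eqZ sq')// -mulrDr.
    by rewrite pmulr_rle0.
  have [a0|a0|->] := ltgtP a 0.
  - by have := pos (- a); rewrite oppr_gt0 scaleNr opprK addrC; apply.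
  - exact: pos.
  - by rewrite scale0r oppr0 (sublinear0 sq') addr0.
have [q'D q'Z] := sublinear_linear sq' lin.
have [g gq'] := riesz ip q'D q'Z.
by exists g => x; rewrite gq'.
Qed.

End finite_dimension.

(** * Equivalence of norms in finite dimension *)

Section norm_equivalence.
Import VectorInternalTheory.
Context {R : realType} {E : normedVectType R}.

Lemma coord_mx_norm n (v : 'rV[R]_n) i : `|v 0 i| <= `|v|.
Proof.
by rewrite [leRHS]/Num.norm/= mx_normrE; apply/bigmax_geP; right; exists (0, i).
Qed.

Lemma norm_r2v (v : 'rV[R]_(dim E)) :
  `|r2v v : E| <= (\sum_i `|stdbasis i : E|) * `|v|.
Proof.
rewrite [r2v v]stdbasisE r2vK mulr_suml (le_trans (ler_norm_sum _ _ _))//.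
apply: ler_sum => i _; rewrite normrZ mulrC ler_wpM2l//.
exact: coord_mx_norm.
Qed.

(** On the compact unit sphere of the coordinate space the continuous map
    [v |-> `|r2v v|] attains a minimum, which is positive; [K] is its inverse. *)
Lemma norm_v2r : exists2 K : R, 0 < K & forall x : E, `|v2r x| <= K * `|x|.
Proof.
pose N (v : 'rV[R]_(dim E)) : R := `|r2v v : E|.
pose M : R := \sum_i `|stdbasis i : E|.
pose S := [set v : 'rV[R]_(dim E) | `|v| = 1].
have cN : continuous N.
  move=> v; apply/(@cvgrPdist_le _ _ _ (nbhs v)) => e e0.
  have M1 : 0 < M + 1 by rewrite ltr_wpDl// sumr_ge0.
  apply/(nbhs_normP v); exists ((M + 1)^-1 * e); first by rewrite /= mulr_gt0// invr_gt0.
  move=> w /= /ltW; rewrite ler_pdivlMl// => vw.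
  rewrite /N (le_trans (ler_dist_dist _ _))// -linearB.
  apply: le_trans (norm_r2v _) _; apply: le_trans vw.
  by rewrite ler_wpM2r// lerDl.
have cS : compact S.
  apply: bounded_closed_compact.
    by exists 1; split => // r r1 v /= ->; rewrite ltW.
  rewrite (_ : S = (fun v : 'rV[R]_(dim E) => `|v|) @^-1` [set 1])//.
  by apply: closed_comp => [v _|]; [exact: norm_continuous|exact: closed_eq].
(* the sphere is empty in dimension 0 *)
have [S0|/set0P S0] := eqVneq S set0.
  exists 1 => // x; rewrite mul1r.
  have [->|x0] := eqVneq (v2r x) 0; first by rewrite normr0.
  suff : S (`|v2r x|^-1 *: v2r x) by rewrite S0.
  by rewrite /S/= normrZ normfV normr_id mulVf// normr_eq0.
have [v] := EVT_min_rV S0 cS (continuous_subspaceT cN).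
rewrite inE /S/= => v1 vmin.
have Nv : 0 < N v.
  rewrite normr_gt0; apply/eqP => rv0; move: v1.
  rewrite -(r2vK v) rv0 linear0 normr0 => /eqP.
  by rewrite eq_sym oner_eq0.
exists (N v)^-1; first by rewrite invr_gt0.
move=> x; rewrite ler_pdivlMl//.
have [->|x0] := eqVneq (v2r x) 0; first by rewrite normr0 mulr0.
have x0' : 0 < `|v2r x| by rewrite normr_gt0.
have := vmin (`|v2r x|^-1 *: v2r x).
rewrite inE /S/= normrZ normfV normr_id mulVf ?gt_eqF// => /(_ erefl).
rewrite /N linearZ/= v2rK normrZ normfV normr_id.
by rewrite ler_pdivlMl// mulrC.
Qed.

Lemma ip_bounded (ip : {dot E for idfun}) :
  exists2 C : R, 0 < C & forall u v, ip u v <= C * `|u| * `|v|.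
Proof.
have [K K0 HK] := norm_v2r.
pose M := \sum_i \sum_j `|ip (stdbasis i) (stdbasis j)|.
have M0 : 0 <= M by apply: sumr_ge0 => i _; exact: sumr_ge0.
exists (M * K ^+ 2 + 1).
  by rewrite ltr_wpDl// mulr_ge0// exprn_ge0// ltW.
move=> u v; apply: (@le_trans _ _ (M * `|v2r u| * `|v2r v|)); last first.
  rewrite -!mulrA mulrDl mul1r ler_wpDr ?mulr_ge0// -mulrA ler_wpM2l//.
  by rewrite expr2 mulrACA ler_pM.
apply: le_trans (ler_norm _) _.
rewrite [u in ip u v]stdbasisE ip_suml !mulr_suml (le_trans (ler_norm_sum _ _ _))//.
apply: ler_sum => i _; rewrite [v in ip _ v]stdbasisE ip_sumr !mulr_suml.
apply: le_trans (ler_norm_sum _ _ _) _; apply: ler_sum => j _.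
rewrite ipZr ipZl !normrM mulrCA mulrA mulrC -[leRHS]mulrA ler_wpM2l//.
by rewrite ler_pM// coord_mx_norm.
Qed.

End norm_equivalence.

(** * Existence of subgradients on a dense set *)

Section subgradients.
Context {R : realType} {E : normedVectType R} (ip : {dot E for idfun}).
Variables (Z : set E) (h : E -> R).
Hypotheses (cZ : convex_set Z) (ch : convex_function Z h).

(** These are the relative interior points of the convex set [Z], described
    algebraically, with [V] the direction of its affine hull. *)
Definition core_point (V : {vspace E}) (c : E) :=
  [/\ Z c, forall d, d \in V -> exists2 t : R, 0 < t & Z (c + t *: d) &
    forall z, Z z -> z - c \in V].

(** Take [c] and [V] such that one can move from [c] inside [Z] in every
    direction of [V], with [V] of largest dimension.  For [z] in [Z], one can
    move from the midpoint of [c] and [z] in the directions of [V] and along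
    [z - c]; by maximality [z - c] is in [V]. *)
Lemma core_point_exists : Z !=set0 -> exists V c, core_point V c.
Proof.
move=> [z0 Zz0].
pose P (V : {vspace E}) c := Z c /\
  forall d, d \in V -> exists2 t : R, 0 < t & Z (c + t *: d).
pose p n := `[< exists V c, \dim V = n /\ P V c >].
have pex : exists n, p n.
  exists 0%N; apply/asboolP; exists 0%VS, z0; split; first by rewrite dimv0.
  split => // d; rewrite memv0 => /eqP ->; exists 1 => //.
  by rewrite scaler0 addr0.
have ple n : p n -> (n <= \dim {:E})%N.
  by move=> /asboolP[V [c [<- _]]]; rewrite dimvS// subvf.
case: (ex_maxnP pex ple) => n /asboolP[V [c [dV [Zc Vc]]]] nmax.
exists V, c; split=> // z Zz.
suff : p (\dim (V + <[z - c]>)%VS).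
  move=> /nmax; rewrite -dV => dle.
  have /geq_leqif := dimv_leqif_sup (addvSl V <[z - c]>).
  rewrite dle => /esym/subvP; apply.
  by rewrite -[X in X \in _]add0r memv_add ?mem0v// memv_line.
apply/asboolP; exists (V + <[z - c]>)%VS, (2^-1 *: c + (1 - 2^-1) *: z).
split => //; split; first by apply: convex_set_segment => //; lra.
move=> d /memv_addP[v Vv [_ /vlineP[k ->] ->]].
have [s s0 Zs] := Vc _ Vv.
(* The point at parameter [t] along [v + k (z - c)] from the midpoint is
   [a (c + (t / a) v) + (1 - a) z] with [a = 1/2 - t k]; this [t] is small
   enough for [a >= 1/4] and [t / a <= s]. *)
pose t := Num.min (s / 4) (4 * (`|k| + 1))^-1.
have k1 : 0 < `|k| + 1 by rewrite ltr_wpDl.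
have t0 : 0 < t by rewrite lt_min !divr_gt0// invr_gt0 mulr_gt0.
have ts : t <= s / 4 by rewrite /t ge_min lexx.
have tk1 : t * (4 * (`|k| + 1)) <= 1.
  by rewrite -ler_pdivlMr ?mulr_gt0// mul1r /t ge_min lexx orbT.
have tk : `|t * k| <= 4^-1.
  rewrite normrM (gtr0_norm t0).
  by have := ltW t0; nra.
exists t => //.
pose a := 2^-1 - t * k.
have /andP[a1 a2] : 4^-1 <= a <= 1.
  by move: tk; rewrite ler_norml /a => /andP[? ?]; apply/andP; split; lra.
have a0 : 0 < a by lra.
have ta : 0 <= t / (a * s) <= 1.
  apply/andP; split; first by rewrite divr_ge0 ?ltW// mulr_gt0.
  by rewrite ler_pdivrMr ?mulr_gt0// mul1r; nra.
have Zcv := convex_set_segment cZ Zs Zc ta.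
have a01 : 0 <= a <= 1 by rewrite ltW.
have := convex_set_segment cZ Zcv Zz a01; congr (Z _).
apply: (@ip_inj _ _ ip) => u; rewrite !(ipDr, ipZr, ipNr) /a.
by field; rewrite (gt_eqF s0)/= gt_eqF//; move: a0; rewrite /a; lra.
Qed.

(** The homothety with centre [z] and ratio [s] maps [Z] into itself and [c] to
    the point considered. *)
Lemma core_point_segment V c z (s : R) : core_point V c -> Z z -> 0 < s <= 1 ->
  core_point V (s *: c + (1 - s) *: z).
Proof.
move=> [Zc Vc cV] Zz /andP[s0 s1].
have s01 : 0 <= s <= 1 by rewrite ltW.
split; first exact: convex_set_segment.
  move=> d /Vc[t t0 Zt]; exists (s * t); first by rewrite mulr_gt0.
  have := convex_set_segment cZ Zt Zz s01; congr (Z _).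
  by apply: (@ip_inj _ _ ip) => u; rewrite !(ipDr, ipZr); ring.
move=> y Zy.
have -> : y - (s *: c + (1 - s) *: z) = (y - c) - (1 - s) *: (z - c).
  by apply: (@ip_inj _ _ ip) => u; rewrite !(ipDr, ipZr, ipNr); ring.
by rewrite memvB// ?memvZ// cV.
Qed.

(** Hahn-Banach applied to the directional derivative
    [q d = inf_(t > 0) (h (w + t d) - h w) / t].  It is finite because one can
    also move from [w] in the direction [- d], and it is defined on the whole
    space by projecting [d] onto [V]. *)
Lemma core_point_subgradient V w : core_point V w -> subdifferential ip Z h w !=set0.
Proof.
move=> [Zw Vw wV].
pose pi := projv V.
pose A d := [set (h (w + t *: pi d) - h w) / t | t in
  [set t : R | 0 < t /\ Z (w + t *: pi d)]].
have An0 d : A d !=set0.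
  have [t t0 Zt] := Vw (pi d) (memv_proj _ _).
  by exists ((h (w + t *: pi d) - h w) / t), t.
have Ahl d : has_lbound (A d).
  have [|s s0 Zs] := Vw (- pi d); first by rewrite memvN memv_proj.
  exists ((h w - h (w + s *: - pi d)) / s) => _ [t [t0 Zt] <-].
  have st0 : 0 < s + t by rewrite addr_gt0.
  have st01 : 0 <= s / (s + t) <= 1.
    by rewrite divr_ge0 ?(ltW s0) ?(ltW st0)//= ler_pdivrMr// mul1r lerDl ltW.
  have := convex_function_chord ch Zt Zs st01.
  have -> : s / (s + t) *: (w + t *: pi d) + (1 - s / (s + t)) *: (w + s *: - pi d) = w.
    apply: (@ip_inj _ _ ip) => u; rewrite !(ipDr, ipZr, ipNr).
    by field; rewrite gt_eqF.
  set x := h (w + t *: _); set y := h (w + s *: _) => hw.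
  rewrite ler_pdivrMr// mulrAC ler_pdivlMr//.
  have : (s + t) * h w <= s * x + t * y.
    rewrite mulrC -ler_pdivlMr//; apply: le_trans hw _.
    by apply: eq_ler; field; rewrite gt_eqF.
  lra.
pose q d := inf (A d).
have qle d t : 0 < t -> Z (w + t *: pi d) -> q d <= (h (w + t *: pi d) - h w) / t.
  by move=> t0 Zt; apply: ge_inf => //; exists t.
have qge d b : (forall t, 0 < t -> Z (w + t *: pi d) ->
    b <= (h (w + t *: pi d) - h w) / t) -> b <= q d.
  by move=> H; apply: lb_le_inf => // _ [t [t0 Zt] <-]; exact: H.
have sq : sublinear q.
  split=> [x y|l x l0].
    rewrite -lerBlDr; apply: (qge) => t t0 Zt.
    rewrite lerBlDr -lerBlDl; apply: (qge) => s s0 Zs.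
    rewrite lerBlDl.
    have st0 : 0 < s + t by rewrite addr_gt0.
    have st01 : 0 <= s / (s + t) <= 1.
      by rewrite divr_ge0 ?(ltW s0) ?(ltW st0)//= ler_pdivrMr// mul1r lerDl ltW.
    (* the step [r] for which [w + r (x + y)] is on the segment between
       [w + t x] and [w + s y] *)
    have r0 : 0 < s * t / (s + t) by rewrite divr_gt0// mulr_gt0.
    have E1 : s / (s + t) *: (w + t *: pi x) + (1 - s / (s + t)) *: (w + s *: pi y)
       = w + (s * t / (s + t)) *: pi (x + y).
      apply: (@ip_inj _ _ ip) => u; rewrite linearD/= !(ipDr, ipZr).
      by field; rewrite gt_eqF.
    have := convex_function_chord ch Zt Zs st01.
    have := convex_set_segment cZ Zt Zs st01; rewrite E1 => Zr hr.
    apply: le_trans (qle _ _ r0 Zr) _.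
    rewrite ler_pdivrMr// lerBlDr; apply: le_trans hr _.
    by apply: eq_ler; field; rewrite !gt_eqF.
  rewrite -ler_pdivrMl//; apply: (qge) => t t0 Zt.
  have t0' : 0 < t / l by rewrite divr_gt0.
  have E1 : w + (t / l) *: pi (l *: x) = w + t *: pi x.
    by rewrite linearZ/= scalerA divfK// gt_eqF.
  have := qle (l *: x) _ t0'; rewrite E1 => /(_ Zt) qt.
  rewrite ler_pdivrMl//; apply: le_trans qt _.
  by apply: eq_ler; field; rewrite !gt_eqF.
have [g gq] := hahn_banach ip sq.
exists g => z Zz.
have E1 : w + 1 *: pi (z - w) = z.
  by rewrite scale1r projv_id ?wV// addrC subrK.
have := qle (z - w) 1 ltr01; rewrite E1 divr1 => /(_ Zz).
by have := gq (z - w); lra.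
Qed.

Lemma subdiff_domain_dense z (e : R) : Z z -> 0 < e ->
  exists2 y, subdiff_domain ip Z h y & `|y - z| < e.
Proof.
move=> Zz e0.
have [V [c Vc]] := core_point_exists (ex_intro _ z Zz).
pose s := Num.min 1 (e / (`|c - z| + 1)).
have n1 : 0 < `|c - z| + 1 by rewrite ltr_wpDl.
have s0 : 0 < s by rewrite lt_min ltr01 divr_gt0.
have s1 : 0 < s <= 1 by rewrite s0 /s ge_min lexx.
have Vs := core_point_segment Vc Zz s1.
exists (s *: c + (1 - s) *: z).
  by split; [case: Vs|exact: core_point_subgradient Vs].
have -> : s *: c + (1 - s) *: z - z = s *: (c - z).
  by apply: (@ip_inj _ _ ip) => u; rewrite !(ipDr, ipZr, ipNr); ring.
rewrite normrZ (gtr0_norm s0).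
apply: (@lt_le_trans _ _ (s * (`|c - z| + 1))).
  by rewrite ltr_pM2l// ltrDl.
by rewrite -ler_pdivlMr// /s ge_min lexx orbT.
Qed.

End subgradients.

(** * Proximal steps *)

Section prox_steps.
Context {R : realType} {E : normedVectType R} (ip : {dot E for idfun}).
Variable S : prox_setup ip.
Let Z := prox_dom S.
Let h := dgf S.
Let dh := grad_dgf S.
Let Zo := subdiff_domain ip Z h.
Let V := bregman ip h dh.

Lemma prox_dom_step x y (s : R) : Z x -> Z y -> 0 <= s <= 1 -> Z (x + s *: (y - x)).
Proof.
move=> Zx Zy s01; have := convex_set_segment (@prox_dom_convex _ _ _ S) Zy Zx s01.
congr (Z _); apply: (@ip_inj _ _ ip) => u; rewrite !(ipDr, ipZr, ipNr); ring.
Qed.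

(** Let [zs = z + s (z' - z)].  If [zs] has a subgradient, convexity gives
    [h zs - h z <= <dh zs, zs - z>], and [dh zs] is close to [dh z] for small
    [s].  In general [zs] is approached by points [y] that have a subgradient,
    and the inequality passes to the limit as [dh y] stays bounded. *)
Lemma directional_derivative_le z z' (e : R) : Zo z -> Z z' -> 0 < e ->
  exists2 s : R, 0 < s <= 1 &
  h (z + s *: (z' - z)) <= h z + s * (ip (dh z) (z' - z) + e).
Proof.
move=> Zoz Zz' e0; set d := z' - z.
have Zz := Zoz.1.
have [C C0 HC] := ip_bounded ip.
have d1 : 0 < `|d| + 1 by rewrite ltr_wpDl.
(* a change of [dh] by at most [e1] changes the slope along [d] by at most [e] *)
pose e1 := e / (C * (`|d| + 1)).
have e10 : 0 < e1 by rewrite divr_gt0// mulr_gt0.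
have Ce1 : C * e1 * `|d| <= e.
  apply: (@le_trans _ _ (C * e1 * (`|d| + 1))).
    by rewrite ler_wpM2l ?lerDl// mulr_ge0 ?ltW.
  by apply: eq_ler; rewrite /e1; field; rewrite !gt_eqF.
have /subspace_continuousP/(_ z Zoz) := @grad_dgf_continuous _ _ _ S.
move=> /cvgrPdist_lt/(_ e1 e10); rewrite near_withinE.
move=> /nbhs_normP[r /= r0 Hr].
pose s := Num.min 1 (r / 2 / (`|d| + 1)).
have s0 : 0 < s by rewrite lt_min ltr01 !divr_gt0.
have s1 : s <= 1 by rewrite /s ge_min lexx.
have sd : s * `|d| <= r / 2.
  apply: (@le_trans _ _ (s * (`|d| + 1))).
    by rewrite ler_wpM2l ?lerDl// ltW.
  by rewrite -ler_pdivlMr// /s ge_min lexx orbT.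
exists s; first by rewrite s0.
pose zs := z + s *: d.
have Zzs : Z zs by apply: prox_dom_step => //; rewrite ltW.
pose G := `|dh z| + e1.
have G0 : 0 < G by rewrite ltr_wpDl.
rewrite -/zs; apply/ler_addgt0Pr => eta eta0.
have eta20 : 0 < eta / 2 by rewrite divr_gt0.
have /subspace_continuousP/(_ zs Zzs) := @dgf_continuous _ _ _ S.
move=> /cvgrPdist_lt/(_ _ eta20); rewrite near_withinE.
move=> /nbhs_normP[r' /= r'0 Hr'].
(* [y] is to be near [zs] for three reasons: to stay where [dh] is close to
   [dh z], to have [h y] close to [h zs], and to make [<dh y, y - zs>] small *)
pose rho := Num.min (r / 2) (Num.min r' (eta / 2 / (C * G))).
have rho0 : 0 < rho by rewrite !lt_min r'0 !divr_gt0// mulr_gt0.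
have [y Zoy yzs] := subdiff_domain_dense ip (@prox_dom_convex _ _ _ S)
  (@dgf_convex _ _ _ S) Zzs rho0.
move: yzs; rewrite !lt_min => /and3P[y1 y2 y3].
have Zy := Zoy.1.
have hy : h zs <= h y + eta / 2.
  have : ball_ Num.norm zs r' y by rewrite /= distrC.
  move=> /Hr'/(_ Zy) /ltW; rewrite ler_norml -/h => /andP[_].
  by rewrite lerBlDl.
have dy : `|dh z - dh y| < e1.
  apply: (Hr y) => //; rewrite /= distrC.
  have -> : y - z = (y - zs) + s *: d.
    by apply: (@ip_inj _ _ ip) => u; rewrite /zs !(ipDr, ipZr, ipNr); ring.
  apply: le_lt_trans (ler_normD _ _) _.
  by rewrite normrZ (gtr0_norm s0); lra.
have Gy : `|dh y| <= G.
  rewrite /G -[dh y](subKr (dh z)); apply: le_trans (ler_normB _ _) _.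
  by rewrite lerD2l ltW.
have sub : h y + ip (dh y) (z - y) <= h z := grad_dgfP Zoy Zz.
have E1 : ip (dh y) (z - y) = - (s * ip (dh z) d) - s * ip (dh y - dh z) d - ip (dh y) (y - zs).
  by rewrite ipBl /zs !(ipDr, ipZr, ipNr); ring.
have b1 : ip (dh y - dh z) d <= e.
  apply: le_trans (HC _ _) _; apply: le_trans Ce1.
  by rewrite ler_wpM2r// ler_wpM2l ?ltW// distrC.
have b2 : ip (dh y) (y - zs) <= eta / 2.
  apply: le_trans (HC _ _) _.
  apply: (@le_trans _ _ (C * G * `|y - zs|)).
    by rewrite ler_wpM2r// ler_wpM2l// ltW.
  by rewrite mulrC -ler_pdivlMr ?mulr_gt0// ltW.
have b3 : s * ip (dh y - dh z) d <= s * e by rewrite ler_wpM2l// ltW.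
by rewrite mulrDr; lra.
Qed.

(** For a small step from [z] towards [z'], [f] lies above its linearization
    at [z] and [h] lies, up to first order, below the one given by [dh z];
    convexity of [f - a h] carries the resulting lower bound on its slope over to [z']. *)
Lemma subgradient_strong_convexity (f : E -> R) (a : R) g z z' : 0 < a ->
  convex_function Z (fun x => f x - a * h x) ->
  Zo z -> Z z' -> subdifferential ip Z f z g ->
  f z + ip g (z' - z) + a * V z z' <= f z'.
Proof.
move=> a0 cf Zoz Zz' fg; have Zz := Zoz.1.
apply/ler_addgt0Pr => e e0.
have ea0 : 0 < e / a by rewrite divr_gt0.
have [s /andP[s0 s1] hs] := directional_derivative_le Zoz Zz' ea0.
have s01 : 0 <= s <= 1 by rewrite ltW.
have := convex_function_chord cf Zz' Zz s01.
have -> : s *: z' + (1 - s) *: z = z + s *: (z' - z).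
  by apply: (@ip_inj _ _ ip) => u; rewrite !(ipDr, ipZr, ipNr); ring.
have := fg _ (prox_dom_step Zz Zz' s01).
rewrite [z + _ - z]addrAC subrr add0r ipZr.
move: hs; set zs := z + _ => hs fs ks.
have ahs : a * h zs <= a * h z + a * s * ip (dh z) (z' - z) + s * e.
  apply: le_trans (ler_wpM2l (ltW a0) hs) _.
  by apply: eq_ler; field; rewrite gt_eqF.
rewrite -(ler_pM2l s0) /V /bregman -/h -/dh.
lra.
Qed.

Lemma bregman_ge0 z z' : Zo z -> Z z' -> 0 <= V z z'.
Proof.
move=> Zoz Zz'; have := grad_dgfP Zoz Zz'.
by rewrite /V /bregman -/h -/dh; lra.
Qed.

(** Minimality of the prox-point [p] says that [dh z - xi] is some subgradient
    of [h] at [p].  It is compared with the selected one, [dh p], through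
    [subgradient_strong_convexity] for [f = h] and [a = 1]: then [f - a h = 0] is convex and
    the terms in [h] cancel. *)
Lemma prox_optimality z xi u : Zo z -> Z u ->
  0 <= ip (xi + dh (prox_map S z xi) - dh z) (u - prox_map S z xi).
Proof.
move=> Zoz Zu; set p := prox_map S z xi.
have Zop : Zo p by exact: prox_map_domain.
have [Zp pmin] := prox_mapP xi Zoz.
have hg : subdifferential ip Z h p (dh z - xi).
  move=> y Zy; have := pmin y Zy; rewrite -/p /bregman -/h -/dh.
  rewrite ipBl !ipBr; lra.
have h0 : convex_function Z (fun x => h x - 1 * h x).
  move=> t x y _ _.
  by rewrite !mul1r !subrr convmm.
have := subgradient_strong_convexity ltr01 h0 Zop Zu hg.
rewrite /V /bregman -/h -/dh !ipBl ipDl.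
lra.
Qed.

Lemma norm_ip_le_dual g v (G : R) : (dual_norm ip g <= G%:E)%E -> ip g v <= G * `|v|.
Proof.
move=> gG; have [->|v0] := eqVneq v 0; first by rewrite linear0r normr0 mulr0.
have nv : 0 < `|v| by rewrite normr_gt0.
rewrite -ler_pdivrMr// mulrC -ipZr -lee_fin; apply: le_trans gG.
apply: ereal_sup_ubound; exists (`|v|^-1 *: v) => //=.
by rewrite normrZ normfV normr_id mulVf// gt_eqF.
Qed.

(** The three-point identity for [V] and optimality of [p] bound
    [gam <g, p - u>] by [V_z(u) - V_p(u) - V_z(p)].  The remaining term
    [gam <g, z - p>] is at most [(gam G)^2]: optimality of [p] tested at [z] and
    strong monotonicity of [dh] give
    [`|z - p|^2 <= gam <g, z - p> <= gam G `|z - p|]. *)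
Lemma prox_step z g u (gam G : R) : Zo z -> Z u -> 0 < gam ->
  (dual_norm ip g <= G%:E)%E ->
  gam * ip g (z - u) <= V z u - V (prox_map S z (gam *: g)) u + (gam * G) ^+ 2.
Proof.
move=> Zoz Zu gam0 gG; set p := prox_map S z _.
have Zop : Zo p by exact: prox_map_domain.
have opt := prox_optimality (gam *: g) Zoz Zu.
have optz := prox_optimality (gam *: g) Zoz Zoz.1.
have mon := dgf_strongly_convex Zoz Zop.
have Vzp := bregman_ge0 Zoz Zop.1.
have gb := norm_ip_le_dual (z - p) gG.
move: opt optz mon Vzp; rewrite -/p /V /bregman -/h -/dh => opt optz mon Vzp.
have npG : gam * ip g (z - p) <= (gam * G) ^+ 2.
  have b : gam * ip g (z - p) <= gam * G * `|z - p|.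
    by rewrite -mulrA ler_wpM2l// ltW.
  have : `|z - p| ^+ 2 <= gam * ip g (z - p).
    by move: optz mon; rewrite !(ipBl, ipDl, ipZl); lra.
  move: b; have := normr_ge0 (z - p); set n := `|z - p|.
  set w := gam * ip g _; set c := gam * G => n0 wc nw.
  by nra.
move: opt Vzp npG; rewrite !(ipBl, ipDl, ipZl, ipDr, ipNr); lra.
Qed.

End prox_steps.

(** * Weighted regret of proximal iterations *)

Section prox_regret.
Context {R : realType} {E : normedVectType R} (ip : {dot E for idfun}).
Variable S : prox_setup ip.

Lemma dual_normN (g : E) (G : R) :
  (dual_norm ip g <= G%:E)%E -> (dual_norm ip (- g)%R <= G%:E)%E.
Proof.
move=> gG; apply: ge_ereal_sup => _ [z /= z1 <-].
apply: le_trans gG; apply: ereal_sup_ubound; exists (- z) => /=.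
  by rewrite normrN.
by rewrite linearNr linearNl.
Qed.

Lemma prox_center_subdiff : subdiff_domain ip (prox_dom S) (dgf S) (prox_center S).
Proof.
have [Zc cmin] := prox_centerP S; split => //.
by exists 0 => z Zz; rewrite linear0l addr0 cmin.
Qed.

Lemma prox_iterates_subdiff (z xi : nat -> E) :
  z 1%N = prox_center S ->
  (forall t, (0 < t)%N -> z t.+1 = prox_map S (z t) (xi t)) ->
  forall t, (0 < t)%N -> subdiff_domain ip (prox_dom S) (dgf S) (z t).
Proof.
move=> z1 zS; elim=> [//|[|t] IH _].
  by rewrite z1; exact: prox_center_subdiff.
by rewrite zS//; apply: prox_map_domain; exact: IH.
Qed.

Variables (z g : nat -> E) (f : nat -> E -> R) (alpha G : R) (a : nat -> R).
Hypothesis alpha0 : 0 < alpha.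
Hypothesis z1 : z 1%N = prox_center S.
Hypothesis zS : forall t, (0 < t)%N ->
  z t.+1 = prox_map S (z t) ((2 / (alpha * t.+1%:R)) *: g t).
Hypothesis alpha_le : forall t, (0 < t)%N -> alpha <= a t.
Hypothesis fconv : forall t, (0 < t)%N ->
  convex_function (prox_dom S) (fun x => f t x - a t * dgf S x).
Hypothesis fsub : forall t, (0 < t)%N ->
  subdifferential ip (prox_dom S) (f t) (z t) (g t).
Hypothesis gG : forall t, (0 < t)%N -> (dual_norm ip (g t) <= G%:E)%E.

(** The subtracted Bregman term is what makes the induction go through: step
    [n] contributes [- alpha n V_(z_n)(x)] from strong convexity, which turns the
    factor [alpha n (n+1) / 2] of [V_(z_n)(x)] into [alpha (n-1) n / 2]. *)
Lemma linear_weight_regret T x : prox_dom S x ->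
  \sum_(1 <= t < T.+1) t%:R * (f t (z t) - f t x) <=
  2 * T%:R * G ^+ 2 / alpha
  - alpha * T%:R * T.+1%:R / 2 * bregman ip (dgf S) (grad_dgf S) (z T.+1) x.
Proof.
move=> Zx; elim: T => [|T IH].
  by rewrite big_geq// !(mulr0, mul0r) subr0.
rewrite big_nat_recr//=; set n := T.+1.
have zdom := prox_iterates_subdiff z1 zS.
have n0 : (0 < n)%N by [].
have Zon := zdom n n0.
have an0 : 0 < a n by apply: lt_le_trans alpha0 (alpha_le n0).
have nR : 0 < n%:R :> R by rewrite ltr0n.
have nR1 : 0 < n.+1%:R :> R by rewrite ltr0n.
have gam0 : 0 < 2 / (alpha * n.+1%:R) by rewrite divr_gt0// mulr_gt0.
have step := prox_step Zon Zx gam0 (gG n0).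
rewrite -zS// in step.
have V0 := bregman_ge0 Zon Zx.
have sc := subgradient_strong_convexity an0 (fconv n0) Zon Zx (fsub n0).
move: IH step V0 sc; rewrite -/n.
set Vn := bregman _ _ _ (z n) x; set Vn1 := bregman _ _ _ (z n.+1) x.
set I := ip _ (z n - x).
have -> : ip (g n) (x - z n) = - I by rewrite /I -opprB linearNr.
set Sum := \sum_(1 <= t < n) _.
move=> IH step V0 sc.
have gap : f n (z n) - f n x <= I - alpha * Vn.
  have := ler_wpM2r V0 (alpha_le n0); lra.
have Ib : n%:R * I <= alpha * n%:R * n.+1%:R / 2 * (Vn - Vn1)
    + 2 * G ^+ 2 / alpha.
  have c0 : 0 <= alpha * n%:R * n.+1%:R / 2 by rewrite !mulr_ge0 ?invr_ge0// ltW.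
  have := ler_wpM2l c0 step.
  have -> : alpha * n%:R * n.+1%:R / 2 * (2 / (alpha * n.+1%:R) * I) = n%:R * I.
    by field; rewrite !gt_eqF.
  move=> H; apply: le_trans H _; rewrite mulrDr lerD2l.
  have -> : alpha * n%:R * n.+1%:R / 2 * (2 / (alpha * n.+1%:R) * G) ^+ 2 =
    2 * G ^+ 2 / alpha * (n%:R / n.+1%:R) by field; rewrite !gt_eqF.
  apply: ler_piMr; first by rewrite divr_ge0 ?(ltW alpha0)// mulr_ge0// sqr_ge0.
  by rewrite ler_pdivrMr// mul1r ler_nat.
have nE : n%:R = T%:R + 1 :> R by rewrite /n -natr1.
have n1E : n.+1%:R = T%:R + 2 :> R by rewrite -natr1 nE; ring.
have gap' := ler_wpM2l (ltW nR) gap.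
apply: le_trans (lerD IH gap') _.
rewrite -subr_ge0; move: Ib; rewrite -subr_ge0 => Ib.
apply: le_trans Ib _.
by apply: eq_ler; rewrite n1E nE; field; rewrite gt_eqF.
Qed.

Lemma prox_regret T x : prox_dom S x -> (0 < T)%N ->
  \sum_(1 <= t < T.+1) 2 * t%:R / (T%:R * T.+1%:R) * (f t (z t) - f t x) <=
  4 * G ^+ 2 / (alpha * T.+1%:R).
Proof.
move=> Zx T0.
have TR : 0 < T%:R :> R by rewrite ltr0n.
have TR1 : 0 < T.+1%:R :> R by rewrite ltr0n.
rewrite (eq_bigr (fun t => 2 / (T%:R * T.+1%:R) * (t%:R * (f t (z t) - f t x)))); last first.
  by move=> t _; ring.
rewrite -mulr_sumr -ler_pdivlMl ?divr_gt0 ?mulr_gt0//.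
apply: le_trans (linear_weight_regret T Zx) _.
have V0 := bregman_ge0 (prox_iterates_subdiff z1 zS (ltn0Sn T)) Zx.
apply: (@le_trans _ _ (2 * T%:R * G ^+ 2 / alpha)).
  by rewrite gerBl !mulr_ge0 ?invr_ge0// ltW.
by apply: eq_ler; field; rewrite !gt_eqF.
Qed.

End prox_regret.

Lemma sum_linear_weights (R : realType) T : (0 < T)%N ->
  \sum_(1 <= t < T.+1) (2 * t%:R / (T%:R * T.+1%:R)) = 1 :> R.
Proof.
move=> T0.
have TR : 0 < T%:R :> R by rewrite ltr0n.
have TR1 : 0 < T.+1%:R :> R by rewrite ltr0n.
have gauss n : \sum_(1 <= t < n.+1) (2 * t%:R) = n%:R * n.+1%:R :> R.
  elim: n => [|n IH]; first by rewrite big_geq// mul0r.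
  by rewrite big_nat_recr//= IH -!natr1; ring.
by rewrite -mulr_suml gauss divff// mulf_neq0 ?gt_eqF.
Qed.

(** * The robust feasibility problem *)

Theorem theorem7 (R : realType) (m : nat)
  (EX : normedVectType R) (EU : 'I_m.+1 -> normedVectType R)
  (ipX : {dot EX for idfun}) (ipU : forall i, {dot (EU i) for idfun})
  (SX : prox_setup ipX) (SU : forall i, prox_setup (ipU i))
  (OmegaU : R) (hOmegaU : forall i, prox_width (SU i) <= OmegaU)
  (f : forall i, EX -> EU i -> R)
  (f_convex : forall i (u : EU i), prox_dom (SU i) u ->
    convex_function (prox_dom SX) (fun x => f i x u))
  (f_concave : forall i (x : EX), prox_dom SX x ->
    convex_function (prox_dom (SU i)) (fun u => - f i x u))
  (gX : forall i, EX -> EU i -> EX) (gU : forall i, EX -> EU i -> EU i)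
  (gX_subgradient : forall i x u, prox_dom SX x -> prox_dom (SU i) u ->
    subdifferential ipX (prox_dom SX) (fun y => f i y u) x (gX i x u))
  (gU_supergradient : forall i x u, prox_dom SX x -> prox_dom (SU i) u ->
    superdifferential (ipU i) (prox_dom (SU i)) (fun v => f i x v) u (gU i x u))
  (GX GU : R)
  (hGX : forall i x u, prox_dom SX x -> prox_dom (SU i) u ->
    (dual_norm ipX (gX i x u) <= GX%:E)%E)
  (hGU : forall i x u, prox_dom SX x -> prox_dom (SU i) u ->
    (dual_norm (ipU i) (gU i x u) <= GU%:E)%E)
  (aU aX : 'I_m.+1 -> R)
  (aU_gt0 : forall i, 0 < aU i) (aX_gt0 : forall i, 0 < aX i)
  (f_strongly_concave : forall i (x : EX), prox_dom SX x ->
    convex_function (prox_dom (SU i)) (fun u => - f i x u - aU i * dgf (SU i) u))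
  (f_strongly_convex : forall i (u : EU i), prox_dom (SU i) u ->
    convex_function (prox_dom SX) (fun x => f i x u - aX i * dgf SX x)) :
  let alphaU := \big[Num.min/aU ord0]_(i < m.+1) aU i in
  let alphaX := \big[Num.min/aX ord0]_(i < m.+1) aX i in
  forall tau : R, 0 < tau < 1 ->
  exists C : R, forall eps : R, 0 < eps ->
  exists2 T0 : nat, (0 < T0)%N /\ T0%:R <= C / eps + 1 &
  forall T : nat, (T0 <= T)%N ->
  forall (x : nat -> EX) (u : nat -> forall i, EU i) (istar : nat -> 'I_m.+1),
    x 1%N = prox_center SX ->
    (forall i, u 1%N i = prox_center (SU i)) ->
    (forall t, (0 < t)%N -> forall j,
       f j (x t) (u t j) <= f (istar t) (x t) (u t (istar t))) ->
    (forall t, (0 < t)%N -> forall i,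
       u t.+1 i = prox_map (SU i) (u t i)
         (- (2 / (alphaU * t.+1%:R)) *: gU i (x t) (u t i))) ->
    (forall t, (0 < t)%N ->
       x t.+1 = prox_map SX (x t)
         (2 / (alphaX * t.+1%:R) *: gX (istar t) (x t) (u t (istar t)))) ->
  solved_by_decision_rule (prox_dom SX) (fun i => prox_dom (SU i)) f
    (fun t => 2 * t%:R / (T%:R * T.+1%:R)) x u tau eps T.
Proof.
move=> alphaU alphaX tau /andP[tau0 tau1].
have aU0 : 0 < alphaU by apply/bigmin_gtP; split.
have aX0 : 0 < alphaX by apply/bigmin_gtP; split.
have aUle i : alphaU <= aU i by apply: bigmin_le.
have aXle i : alphaX <= aX i by apply: bigmin_le.
have tau'0 : 0 < 1 - tau by rewrite subr_gt0.
pose CU := 4 * GU ^+ 2 / alphaU.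
pose CX := 4 * GX ^+ 2 / alphaX.
have CU0 : 0 <= CU by rewrite divr_ge0 ?(ltW aU0)// mulr_ge0// sqr_ge0.
have CX0 : 0 <= CX by rewrite divr_ge0 ?(ltW aX0)// mulr_ge0// sqr_ge0.
have CUt : 0 <= CU / tau by rewrite divr_ge0// ltW.
have CXt : 0 <= CX / (1 - tau) by rewrite divr_ge0// ltW.
exists (CU / tau + CX / (1 - tau)) => eps eps0.
set C := CU / tau + _.
have C0 : 0 <= C by rewrite addr_ge0.
have Ce0 : 0 <= C / eps by rewrite divr_ge0// ltW.
have /andP[trle trgt] := truncn_itv Ce0.
exists (Num.truncn (C / eps)).+1.
  by split; rewrite // -natr1 lerD2r.
move=> T T0T x u istar x1 u1 istarP uS xS.
have T0 : (0 < T)%N by apply: leq_trans T0T.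
have TR : 0 < T%:R :> R by rewrite ltr0n.
have TR1 : 0 < T.+1%:R :> R by rewrite ltr0n.
have CT : C <= eps * T.+1%:R.
  rewrite -ler_pdivrMl// mulrC; apply: le_trans (ltW trgt) _.
  by rewrite ler_nat (leq_trans T0T).
(* [C] bounds both [CU / tau] and [CX / (1 - tau)], so that each regret fits
   into its share of [eps] *)
have gapU : CU / T.+1%:R <= tau * eps.
  rewrite ler_pdivrMr// -mulrA -ler_pdivrMl// mulrC; apply: le_trans CT.
  by rewrite lerDl.
have gapX : CX / T.+1%:R <= (1 - tau) * eps.
  rewrite ler_pdivrMr// -mulrA -ler_pdivrMl// mulrC; apply: le_trans CT.
  by rewrite lerDr.
pose theta t : R := 2 * t%:R / (T%:R * T.+1%:R).
have theta0 t : t \in index_iota 1 T.+1 -> 0 < theta t.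
  rewrite mem_index_iota => /andP[t0 _].
  by rewrite divr_gt0 ?mulr_gt0// ltr0n.
have Xx t : (0 < t)%N -> prox_dom SX (x t).
  by move=> t0; exact: (prox_iterates_subdiff x1 xS t0).1.
have uS' i t : (0 < t)%N -> u t.+1 i = prox_map (SU i) (u t i)
    ((2 / (alphaU * t.+1%:R)) *: - gU i (x t) (u t i)).
  by move=> t0; rewrite uS// scaleNr scalerN.
have Uu i t : (0 < t)%N -> prox_dom (SU i) (u t i).
  by move=> t0; exact: (@prox_iterates_subdiff _ _ _ (SU i) (fun t => u t i) _ (u1 i) (uS' i) t t0).1.
have regretU i v : prox_dom (SU i) v ->
    \sum_(1 <= t < T.+1) theta t * (f i (x t) v - f i (x t) (u t i)) <=
    CU / T.+1%:R.
  move=> Uv.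
  have := @prox_regret _ _ _ (SU i) (fun t => u t i)
    (fun t => - gU i (x t) (u t i)) (fun t w => - f i (x t) w) alphaU GU (fun=> aU i)
    aU0 (u1 i) (uS' i) (fun t _ => aUle i) _ _ _ T v Uv T0.
  have -> : 4 * GU ^+ 2 / (alphaU * T.+1%:R) = CU / T.+1%:R by rewrite invfM mulrA.
  under eq_bigr => t _ do rewrite opprK addrC.
  apply => t t0.
  - exact: f_strongly_concave (Xx t t0).
  - move=> w Uw; have := gU_supergradient i _ _ (Xx t t0) (Uu i t t0) w Uw.
    by rewrite -[- gU _ _ _]scaleN1r ipZl; lra.
  - by apply: dual_normN; apply: hGU; [exact: Xx|exact: Uu].
have regretX y : prox_dom SX y ->
    \sum_(1 <= t < T.+1) theta t * (f (istar t) (x t) (u t (istar t))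
      - f (istar t) y (u t (istar t))) <= CX / T.+1%:R.
  move=> Xy.
  have := @prox_regret _ _ _ SX x
    (fun t => gX (istar t) (x t) (u t (istar t)))
    (fun t y => f (istar t) y (u t (istar t))) alphaX GX (fun t => aX (istar t))
    aX0 x1 xS (fun t _ => aXle (istar t)) _ _ _ T y Xy T0.
  have -> : 4 * GX ^+ 2 / (alphaX * T.+1%:R) = CX / T.+1%:R by rewrite invfM mulrA.
  apply => t t0.
  - exact: f_strongly_convex (Uu _ t t0).
  - exact: gX_subgradient (Xx t t0) (Uu _ t t0).
  - by apply: hGX; [exact: Xx|exact: Uu].
rewrite /solved_by_decision_rule.
set s := (s in \big[_/s ord0]_(i < _) s i).
have sum_theta := sum_linear_weights R T0.
case: ifPn => [smax|].
  have sle i : s i <= (1 - tau) * eps by apply: le_trans smax; exact: le_bigmax.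
  have jen i v : prox_dom (SU i) v -> prox_dom SX (\sum_(1 <= t < T.+1) theta t *: x t) /\
      f i (\sum_(1 <= t < T.+1) theta t *: x t) v <=
      \sum_(1 <= t < T.+1) theta t * f i (x t) v.
    move=> Uv.
    have := jensen (prox_dom_convex (p:=SX)) (f_convex i v Uv) (s := index_iota 1 T.+1)
      (w := theta) (x := x).
    rewrite size_iota subn1 /= sum_theta invr1 !scale1r mul1r => -[]//.
    by move=> t; rewrite mem_index_iota => /andP[t0 _]; exact: Xx.
  split; first by have [] := jen ord0 _ (Uu ord0 1%N isT).
  move=> i; apply: ge_ereal_sup => _ [v Uv <-]; rewrite lee_fin.
  have [_ h] := jen i v Uv; apply: le_trans h _.
  have := le_trans (regretU i v Uv) gapU.
  under eq_bigr => t _ do rewrite mulrBr.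
  rewrite sumrB -/(s i) lerBlDr => h; apply: le_trans h _.
  by have := sle i; lra.
move=> smax y Xy; apply: contrapT => /forallNP noi.
have fle0 i v : prox_dom (SU i) v -> f i y v <= 0.
  move=> Uv; have /negP := noi i; rewrite -leNgt => H.
  rewrite -lee_fin; apply: le_trans H; apply: ereal_sup_ubound.
  by exists v.
move/negP: smax; apply; apply/bigmax_leP.
suff sle i : s i <= (1 - tau) * eps by split.
apply: le_trans gapX; apply: le_trans (regretX y Xy).
apply: ler_sum_nat => t /andP[t0 _].
have tt : 0 <= theta t by rewrite divr_ge0// ?mulr_ge0.
rewrite ler_wpM2l//.
have := istarP t t0 i; have := fle0 _ _ (Uu (istar t) t t0); lra.
Qed.
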